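(* For all $n\ge 1$, $R_n\subseteq H_n$, where $R_n=\{w\in\mathfrak{S}_n : Q(w)=Q(w^r)\}$ and $H_n=\{w\in\mathfrak{S}_n : Q(w) \text{ has symmetric hook shape}\}$. That is, $Q(w)$ has a symmetric hook shape for every $w\in\mathfrak{S}_n$ with $Q(w)=Q(w^r)$.
   Context: Permutations are written in one-line notation $w=w_1\dots w_n$, and $w^r=w_n\dots w_1$. $Q(w)$ denotes the recording tableau of $w$ under the Robinson–Schensted correspondence (Schensted row insertion of $w_1,\dots,w_n$; the cell containing $k$ in $Q(w)$ is the cell created at the $k$-th insertion). A shape is symmetric if it equals its transpose; a hook shape is of the form $(k,1^{n-k})$. A symmetric hook shape of size $n$ is $((n+1)/2,1^{(n-1)/2})$ with $n$ odd (for $n=1$, the single box, so $H_1=\mathfrak{S}_1$); in particular $H_n=\emptyset$ for even $n$. *)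

(* Defs.v *)
From mathcomp Require Import all_boot all_fingroup.

Set Implicit Arguments.
Unset Strict Implicit.
Unset Printing Implicit Defensive.

(* A tableau is the list of its rows, top row first (English convention). *)
Definition tableau := seq (seq nat).

(* Schensted insertion of x into a row: x replaces the leftmost entry y > x,
   which is bumped and returned; if there is none, x is appended. *)
Fixpoint row_insert (x : nat) (r : seq nat) : seq nat * option nat :=
  if r is y :: r' then
    if x < y then (x :: r', Some y)
    else let: (r'', b) := row_insert x r' in (y :: r'', b)
  else ([:: x], None).

(* Returns the new tableau and the index of the row that gained a cell. *)
Fixpoint tab_insert (x : nat) (T : tableau) : tableau * nat :=
  if T is r :: T' then
    let: (r', b) := row_insert x r in
    if b is Some y then let: (T'', i) := tab_insert y T' in (r' :: T'', i.+1)
    else (r' :: T', 0)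
  else ([:: [:: x]], 0).

(* Since P and Q keep the same shape, the cell just created at the end of row i
   of P is the one added here at the end of row i of Q. *)
Definition add_cell (k i : nat) (Q : tableau) : tableau :=
  set_nth [::] Q i (rcons (nth [::] Q i) k).

Definition RS_step (PQ : tableau * tableau) (xk : nat * nat) :
    tableau * tableau :=
  let: (P', i) := tab_insert xk.1 PQ.1 in (P', add_cell xk.2 i PQ.2).

Definition RS (s : seq nat) : tableau * tableau :=
  foldl RS_step ([::], [::]) (zip s (iota 1 (size s))).

(* The word w_1 ... w_n with letters 1, ..., n; 'I_n is indexed from 0. *)
Definition one_line (n : nat) (w : 'S_n) : seq nat :=
  [seq (val (w i)).+1 | i <- enum 'I_n].

Definition Qtab (n : nat) (w : 'S_n) : tableau := (RS (one_line w)).2.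

(* In {perm T}, (s * t) i = t (s i), so this is i |-> w (n - 1 - i). *)
Definition perm_rev (n : nat) (w : 'S_n) : 'S_n :=
  (perm (@rev_ord_inj n) * w)%g.

Lemma one_line_rev (n : nat) (w : 'S_n) :
  one_line (perm_rev w) = rev (one_line w).
Proof.
have sz (v : 'S_n) : size (one_line v) = n by rewrite size_map size_enum_ord.
apply: (@eq_from_nth _ 0) => [|i]; rewrite ?size_rev !sz // => lt_in.
rewrite nth_rev sz //.
have nthE (v : 'S_n) (j : 'I_n) : nth 0 (one_line v) j = (val (v j)).+1.
  by rewrite (nth_map j) ?size_enum_ord // nth_ord_enum.
by rewrite (nthE _ (Ordinal lt_in)) (nthE _ (rev_ord (Ordinal lt_in))) permM permE.
Qed.

Definition shape (T : tableau) : seq nat := map size T.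

Definition transpose_shape (sh : seq nat) : seq nat :=
  [seq count (fun r => j < r) sh | j <- iota 0 (head 0 sh)].

Definition symmetric_shape (sh : seq nat) : bool := transpose_shape sh == sh.

Definition hook_shape (sh : seq nat) : bool :=
  if sh is k :: s then (0 < k) && (s == nseq (size s) 1) else false.

Lemma hook_shapeP (sh : seq nat) :
  reflect (exists k m, 0 < k /\ sh = k :: nseq m 1) (hook_shape sh).
Proof.
apply: (iffP idP) => [|[k [m [k_gt0 ->]]]].
  by case: sh => //= k s /andP[k_gt0 /eqP s1]; exists k, (size s); rewrite -s1.
by rewrite /= k_gt0 size_nseq eqxx.
Qed.

Definition symmetric_hook (sh : seq nat) : bool :=
  symmetric_shape sh && hook_shape sh.

Lemma symmetric_hookP (sh : seq nat) :
  reflect (exists m, sh = m.+1 :: nseq m 1) (symmetric_hook sh).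
Proof.
apply: (iffP andP) => [[/eqP sym /hook_shapeP[k [m [_ def_sh]]]]|[m ->]].
  exists m; have := congr1 size sym.
  by rewrite size_map size_iota def_sh /= size_nseq => ->.
split; last by apply/hook_shapeP; exists m.+1, m.
rewrite /symmetric_shape /transpose_shape /= count_nseq mul1n add1n.
apply/eqP; congr cons.
apply: (@eq_from_nth _ 0) => [|i]; rewrite size_map size_iota ?size_nseq //.
move=> lt_im; rewrite (nth_map 0) ?size_iota // nth_iota // nth_nseq lt_im.
by rewrite add1n count_nseq ltnS lt_im.
Qed.

Definition R_set (n : nat) : {set 'S_n} :=
  [set w : 'S_n | Qtab w == Qtab (perm_rev w)].

Definition H_set (n : nat) : {set 'S_n} :=
  [set w : 'S_n | symmetric_hook (shape (Qtab w))].

(* Main.v *)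
Require Import Defs.
From mathcomp Require Import all_boot all_fingroup.
From mathcomp Require Import zify_ssreflect.

Set Implicit Arguments.
Unset Strict Implicit.
Unset Printing Implicit Defensive.

(** Write [sh w] for the shape of the insertion tableau of [w].  If [Q(w) = Q(w^r)]
    and [w = x u y], then [Q(u) = Q(u^r)]: dropping the last letter deletes the
    largest entry of [Q], and dropping the first one is a jeu de taquin slide, so
    in both cases the new [Q] depends only on the old one.  By induction [sh u] is
    a symmetric hook.  Now [sh w] is [sh u] plus two cells, and it is symmetric
    because [sh (w^r)] is the conjugate of [sh w]; a symmetric shape with two more
    cells than a symmetric hook is again a symmetric hook.

    Both facts about prepending a letter (the slide, and that it acts on shapes as
    column insertion) are proved by induction on the length, deleting the largest
    letter [m] of the word: this removes one cell from the shape, and the cell of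
    [m] after an insertion is determined by its cell before the insertion. *)

(** * Shapes as row-length functions; insertion in the presence of a largest letter *)

Definition row_len (T : tableau) (k : nat) : nat := size (nth [::] T k).

Definition covers (i : nat) (S S' : nat -> nat) : Prop :=
  forall k, S' k = S k + (k == i).

Definition antitone (S : nat -> nat) : Prop := forall i j, i <= j -> S j <= S i.

Lemma covers_inj S S' i j : covers i S S' -> covers j S S' -> i = j.
Proof. by move=> /(_ i) + /(_ i); rewrite eqxx => -> /addnI; case: eqP. Qed.

Lemma row_len_add_cell m i T : covers i (row_len T) (row_len (add_cell m i T)).
Proof.
move=> k; rewrite /row_len nth_set_nth /=; case: eqP => [->|_].
  by rewrite size_rcons addn1.
by rewrite addn0.
Qed.

Lemma row_insert_lt m x r : x < m -> all (gtn m) r ->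
  all (gtn m) (row_insert x r).1 /\
  (forall y, (row_insert x r).2 = Some y -> y < m).
Proof.
move=> xm; elim: r => [|y r IH] /=; first by rewrite xm.
case/andP=> ym rm; case: ifP => _ /=; first by rewrite xm rm; split=> // _ [<-].
by case: (IH rm); case: row_insert => r'' b /= -> h; rewrite ym.
Qed.

Lemma tab_insert_lt m x T : x < m -> all (all (gtn m)) T ->
  all (all (gtn m)) (tab_insert x T).1.
Proof.
elim: T x => [|r T IH] x xm /=; first by rewrite xm.
case/andP=> rm Tm; case: (row_insert_lt xm rm); case: row_insert => r' [y|] /= rm' ym.
  by move: (IH y (ym _ erefl) Tm); case: tab_insert => T'' i /= ->; rewrite rm'.
by rewrite rm' Tm.
Qed.

Lemma row_insert_size x r : size (row_insert x r).1 =
  size r + ((row_insert x r).2 == None).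
Proof.
elim: r => [|y r IH] //=; case: ifP => _ /=; first by rewrite addn0.
by move: IH; case: row_insert => r'' b /= ->; rewrite addSn.
Qed.

Lemma tab_insert_index x T :
  let: (T', j) := tab_insert x T in
  [/\ covers j (row_len T) (row_len T'), j <= size T &
      size T' = maxn j.+1 (size T)].
Proof.
elim: T x => [|r T IH] x /=; first by split=> // -[|k] //; rewrite /row_len /= !nth_nil.
move: (row_insert_size x r); case: row_insert => r' [y|] /= sz_r'; last first.
  split=> //; last by rewrite maxnSS max0n.
  by case=> [|k]; rewrite /row_len /= ?sz_r' ?addn0.
move: (IH y); case: tab_insert => T'' i [cov iT /= ->].
split=> //; last by rewrite maxnSS.
by case=> [|k]; [rewrite /row_len /= sz_r' | apply: cov].
Qed.

Lemma row_insert_max m r : all (gtn m) r -> row_insert m r = (rcons r m, None).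
Proof.
elim: r => //= y r IH /andP[ym rm].
by rewrite ltnNge (ltnW ym) /= IH.
Qed.

Lemma tab_insert_max m T : all (all (gtn m)) T ->
  tab_insert m T = (add_cell m 0 T, 0).
Proof. by case: T => [|r T] //= /andP[rm _]; rewrite row_insert_max. Qed.

Lemma row_insert_rcons_max m x r : x < m ->
  row_insert x (rcons r m) =
  if (row_insert x r).2 is Some y then (rcons (row_insert x r).1 m, Some y)
  else ((row_insert x r).1, Some m).
Proof.
move=> xm; elim: r => [|y r IH] /=; first by rewrite xm.
case: ifP => _ //=; rewrite IH.
by case: row_insert => r' [].
Qed.

(** Insertion of [x] disturbs [m] only when the new cell falls in row [i]: it takes the place of
    [m], which, being largest, is appended to the next row. The bound on [i] keeps [add_cell] from
    padding with empty rows. *)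
Lemma tab_insert_add_max m x T i : x < m -> all (all (gtn m)) T -> i <= size T ->
  tab_insert x (add_cell m i T) =
  let: (T', j) := tab_insert x T in
  if i == j then (add_cell m i.+1 T', i.+1) else (add_cell m i T', j).
Proof.
elim: T x i => [|r T IH] x i xm; first by case: i => //= _ _; rewrite xm.
move=> /= /andP[rm Tm]; case: i => [|i] /= iT.
  rewrite /add_cell /= row_insert_rcons_max //.
  case: row_insert => r' [y|] /=; first by case: tab_insert.
  by rewrite tab_insert_max //=; case: (T).
case: (row_insert_lt xm rm); rewrite /add_cell /=.
case: row_insert => r' [y|] //= _ ym.
move: (IH y i (ym _ erefl) Tm iT); rewrite /add_cell => ->.
by case: tab_insert => T'' j; rewrite eqSS; case: ifP.
Qed.

(** * Insertion tableaux and shapes of words *)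

Definition Ptab (w : seq nat) : tableau := (RS w).1.
Definition sh (w : seq nat) : nat -> nat := row_len (Ptab w).

Lemma RS_rcons w x : RS (rcons w x) = RS_step (RS w) (x, (size w).+1).
Proof.
rewrite /RS size_rcons -[X in iota _ X]addn1 iotaD cats1 zip_rcons ?size_iota //.
by rewrite foldl_rcons add1n.
Qed.

Lemma Ptab_rcons w x : Ptab (rcons w x) = (tab_insert x (Ptab w)).1.
Proof.
by rewrite /Ptab RS_rcons /RS_step /=; case: tab_insert.
Qed.

Lemma Ptab_lt m w : all (gtn m) w -> all (all (gtn m)) (Ptab w).
Proof.
elim/last_ind: w => //= w x IH; rewrite all_rcons => /andP[xm /IH wm].
by rewrite Ptab_rcons; apply: tab_insert_lt.
Qed.

Lemma Ptab_insert_max m u1 u2 : all (gtn m) (u1 ++ u2) ->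
  exists2 i, i <= size (Ptab (u1 ++ u2)) &
    Ptab (u1 ++ m :: u2) = add_cell m i (Ptab (u1 ++ u2)).
Proof.
elim/last_ind: u2 => [|u2 y IH].
  rewrite cats0 cats1 Ptab_rcons => /Ptab_lt um.
  by exists 0 => //; rewrite tab_insert_max.
rewrite -rcons_cons -!rcons_cat all_rcons => /andP[ym um].
case: (IH um) => i iP Pm.
rewrite !Ptab_rcons Pm tab_insert_add_max ?Ptab_lt //.
have := tab_insert_index y (Ptab (u1 ++ u2)).
case: tab_insert => T' j [_ _ szT'] /=; case: eqP => [ij|_] /=.
  by exists i.+1; rewrite // szT' ij leq_maxl.
by exists i => //; rewrite szT' leq_max iP orbT.
Qed.

Lemma sh_rcons w y : exists b, covers b (sh w) (sh (rcons w y)).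
Proof.
rewrite /sh Ptab_rcons; have := tab_insert_index y (Ptab w).
by case: tab_insert => T' j [cov _ _]; exists j.
Qed.

Lemma sh_rcons_max w m : all (gtn m) w -> covers 0 (sh w) (sh (rcons w m)).
Proof.
by move=> wm; rewrite /sh Ptab_rcons tab_insert_max ?Ptab_lt //; apply: row_len_add_cell.
Qed.

(** * Local rules for pairs of added cells, and their compatibility on a cube *)

(** Fomin's local rule: [S] to [A] adds the cell of the largest letter, [S] to [B] the cell of an
    appended letter, and the former is bumped one row down exactly when the two coincide. *)
Definition row_rule (S A B D : nat -> nat) : Prop :=
  exists a b r, [/\ covers a S A, covers b S B, covers r B D &
    r = if a == b then a.+1 else a].

(* [r] is the row of a cell in the column following that of the cell added to
   row [a]; it is unique as [D] is a partition. *)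
Definition col_rule (S A C D : nat -> nat) : Prop :=
  exists a g r, [/\ covers a S A, covers g S C, covers r C D &
    if a == g then C r = C a else r = a].

(* When [b = g], the new cell is to the right of the first one or below it. *)
Definition jdt_square (S B C D : nat -> nat) : Prop :=
  exists b g d, [/\ covers b S B, covers g S C, covers d C D &
    if b == g then d = g \/ d = g.+1 /\ S g.+1 = S g else d = b].

Lemma sh_row_rule u1 m u2 y : all (gtn m) (rcons (u1 ++ u2) y) ->
  row_rule (sh (u1 ++ u2)) (sh (u1 ++ m :: u2))
           (sh (rcons (u1 ++ u2) y)) (sh (rcons (u1 ++ m :: u2) y)).
Proof.
rewrite all_rcons => /andP[ym um].
case: (Ptab_insert_max um) => i iP Pm; rewrite /sh !Ptab_rcons Pm.
rewrite tab_insert_add_max ?Ptab_lt //.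
have := tab_insert_index y (Ptab (u1 ++ u2)).
case: tab_insert => T' j [cov _ _] /=.
exists i, j, (if i == j then i.+1 else i).
split=> //; first exact: row_len_add_cell.
by case: eqP => _ /=; apply: row_len_add_cell.
Qed.

(** The edges at [S] stand for adding a largest letter ([A]), a last letter ([B']) and a first
    letter ([C']). Adjacent faces share edges, so both [row_rule] faces and one face of each other
    kind force the two remaining faces. *)
Lemma jdt_cube S A B' C' D' B C D :
  antitone A -> antitone C' -> antitone C -> antitone D' ->
  row_rule S A B' B -> col_rule S A C' C -> jdt_square S B' C' D' ->
  row_rule C' C D' D -> col_rule B' B D' D /\ jdt_square A B C D.
Proof.
move=> aA aC' aC aD' [a [b [rB [cA cB' cB eB]]]] [a_ [g [rC [cA_ cC' cC eC]]]].
move=> [b_ [g_ [d [cB'_ cC'_ cD' ed]]]] [rC_ [d_ [r [cC_ cD'_ cD er]]]].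
move: (covers_inj cA_ cA) (covers_inj cB'_ cB') (covers_inj cC'_ cC').
move: (covers_inj cC_ cC) (covers_inj cD'_ cD').
move=> ????? {cA_ cB'_ cC'_ cC_ cD'_}; subst a_ b_ g_ rC_ d_.
(* The other four edges, each found by comparing the two paths around a known face. *)
have cD'B : covers (if b == g then d else g) B' D'.
  by move=> k; rewrite cD' cC' cB'; case: ifP ed => [/eqP->|_ ->] //; lia.
have cAB : covers (if a == b then a.+1 else b) A B.
  by move=> k; rewrite cB cB' cA eB; case: ifP => [/eqP->|_] //; lia.
have cAC : covers (if a == g then rC else g) A C.
  by move=> k; rewrite cC cC' cA; case: ifP eC => [/eqP->|_ ->] //; lia.
have cCD : covers (if rC == d then rC.+1 else d) C D.
  by move=> k; rewrite cD cD' cC er; case: ifP => [/eqP->|_] //; lia.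
suff [h1 h2] : (if rB == (if b == g then d else g) then D' r = D' rB else r = rB) /\
  (if (if a == b then a.+1 else b) == (if a == g then rC else g)
   then (if rC == d then rC.+1 else d) = (if a == g then rC else g)
     \/ (if rC == d then rC.+1 else d) = (if a == g then rC else g).+1
      /\ A (if a == g then rC else g).+1 = A (if a == g then rC else g)
    else (if rC == d then rC.+1 else d) = (if a == b then a.+1 else b)).
  by split; [exists rB, (if b == g then d else g), r |
    exists (if a == b then a.+1 else b), (if a == g then rC else g),
      (if rC == d then rC.+1 else d)].
move=> {cD'B cAB cAC cCD}.
have [ab|ab] := eqVneq a b.
  have [ag|ag] := eqVneq a g.
    subst b g; rewrite !eqxx in eB eC ed *.
    move: (cC' a) (cC' a.+1) (cD' a) (cD' a.+1) (cC a) (cC rC) (cD' rC).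
    move: (aC a rC) (aD' rC a).
    subst rB; case: ed er => [->|[-> e]] er ?????????.
      (* [C] and [D'] each add to [C'] a cell in the same column, and a partition has one addable
         cell per column. *)
      have rCa : rC = a by lia.
      by subst rC; rewrite er eqxx; split; case: eqP => //; lia.
    have rCa : rC != a.+1 by lia.
    by rewrite er (eq_sym _ rC) (negbTE rCa) eqxx; split=> //; lia.
  subst b; rewrite eqxx (negbTE ag) in eB eC ed *.
  by rewrite eB er eC ed eqxx; case: ifP => [/eqP->|_]; split=> //; left.
have [ag|ag] := eqVneq a g.
  subst g; rewrite eqxx (eq_sym b) (negbTE ab) in eB eC ed *.
  rewrite eB eqxx er ed (eq_sym rC) in cD' *; have [rb|rb] := eqVneq b rC; last first.
    by split=> //; rewrite !cD'; lia.
  subst rC; move: (aD' a b) (aC' b.+1 a) (aC' b b.+1); rewrite !cD'.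
  (* As [D'] is a partition, [b < a]; rows [b] and [a] of [C'] are equally long, hence so are those
     between. *)
  move=> ???; have e : C' b.+1 = C' b by lia.
  by split; [lia | right; rewrite !cA -!cC'].
rewrite (negbTE ab) (negbTE ag) in eB eC ed *; subst rB rC.
have [bg|bg] := eqVneq b g.
  subst g; rewrite eqxx in ed *.
  move: (aA b b.+1 (leqnSn b)) (cA b) (cA b.+1) => ???.
  (* Otherwise [a = b.+1] with [S b.+1 = S b], and [A] would not be a partition. *)
  have ad : a != d by lia.
  rewrite er (negbTE ad); split=> //; lia.
by rewrite (negbTE bg) in ed; subst d; rewrite (negbTE ab) in er *;
  rewrite er (negbTE ag).
Qed.

(** * Splitting a word at its largest letter; shapes are partitions *)

Lemma max_split (w : seq nat) : uniq w -> w != [::] ->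
  exists w1 m w2, w = w1 ++ m :: w2 /\ all (gtn m) (w1 ++ w2).
Proof.
elim: w => // x w IH /= /andP[xw uw] _.
have [->|w0] := eqVneq w [::]; first by exists [::], x, [::].
have [w1 [m [w2 [ew wm]]]] := IH uw w0; subst w.
have : x != m by apply: contraNneq xw => ->; rewrite mem_cat inE eqxx orbT.
rewrite neq_ltn => /orP[xm|mx].
  by exists (x :: w1), m, w2; rewrite /= xm.
exists [::], x, (w1 ++ m :: w2); split=> //=.
move: wm; rewrite !all_cat /= mx => /andP[h1 h2].
by apply/andP; split; [apply: sub_all h1 | apply: sub_all h2] => z /= /ltn_trans; apply.
Qed.

Lemma uniq_remove (w1 w2 : seq nat) m : uniq (w1 ++ m :: w2) -> uniq (w1 ++ w2).
Proof.
by rewrite -[_ :: w2]cat1s uniq_catCA /= => /andP[].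
Qed.

Lemma antitone_sh (w : seq nat) : uniq w -> antitone (sh w).
Proof.
have [n] := ubnP (size w); elim: n w => // n IH w.
rewrite ltnS => szw uw; have [->|w0] := eqVneq w [::].
  by move=> i j _; rewrite /sh /row_len /= nth_nil.
have [w1 [m [w2 [ew wm]]]] := max_split uw w0.
move: ew wm szw uw {w0}; case/lastP: w2 => [|w2 y] -> wm szw uw.
  rewrite cats1 cats0 in wm szw uw *.
  have aw1 : antitone (sh w1).
    by apply: IH; [move: szw; rewrite size_rcons | move: uw; rewrite rcons_uniq => /andP[]].
  move=> i j ij; rewrite !(sh_rcons_max wm); move: (aw1 i j ij); lia.
rewrite -rcons_cons -!rcons_cat in wm szw uw *.
have [a [b [r [cA cB cD er]]]] := sh_row_rule wm.
have uw' : uniq (w1 ++ m :: w2) by move: uw; rewrite rcons_uniq => /andP[].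
have u2 : uniq (rcons (w1 ++ w2) y).
  by move: uw; rewrite !rcons_cat rcons_cons => /uniq_remove.
rewrite size_rcons size_cat /= addnS in szw.
have aS : antitone (sh (w1 ++ w2)).
  by apply: IH; [rewrite size_cat; lia | apply: uniq_remove uw'].
have aA : antitone (sh (w1 ++ m :: w2)) by apply: IH; [rewrite size_cat /=; lia|].
have aB : antitone (sh (rcons (w1 ++ w2) y)) by apply: IH; [rewrite size_rcons size_cat; lia|].
move=> i j ij; move: (aS i j ij) (aA i j ij) (aB i j ij).
move: (aA i a) (aS a a.+1 (leqnSn a)).
rewrite !cD !cB !cA {}er; have [<-|ab] := eqVneq a b; last lia.
by case: (eqVneq j a.+1) ij => [->|]; lia.
Qed.

(** * Prepending a letter: column insertion and the jeu de taquin slide *)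

(** Column insertion of [x], seen on shapes: a largest letter goes to the foot of the first column;
    otherwise the rule tells how the cell of the largest letter [m] of [w] moves. *)
Definition col_insertion (w : seq nat) (x : nat) : Prop :=
  (all (gtn x) w -> exists2 g, covers g (sh w) (sh (x :: w)) & sh w g = 0) /\
  (forall w1 m w2, w = w1 ++ m :: w2 -> all (gtn m) (x :: w1 ++ w2) ->
    col_rule (sh (w1 ++ w2)) (sh w) (sh (x :: w1 ++ w2)) (sh (x :: w))).

(** A strict maximum occurs only once. Hence the second clause of [col_insertion], which ranges over
    all splittings, need only be checked on one. *)
Lemma max_split_inj (w1 w2 w1' w2' : seq nat) m m' :
  w1 ++ m :: w2 = w1' ++ m' :: w2' ->
  all (gtn m) (w1 ++ w2) -> all (gtn m') (w1' ++ w2') ->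
  [/\ w1 = w1', m = m' & w2 = w2'].
Proof.
move=> e h h'; have em : m = m'.
  have [] : m \in w1' ++ m' :: w2' /\ m' \in w1 ++ m :: w2.
    by rewrite -e {2}e !mem_cat !inE !eqxx !orbT.
  rewrite !mem_cat !inE orbCA -mem_cat => /orP[/eqP//|/(allP h') /= lt1].
  by rewrite orbCA -mem_cat => /orP[/eqP//|/(allP h) /= lt2]; lia.
subst m'; have n1 : m \notin w1 ++ w2 by apply/negP=> /(allP h) /=; rewrite ltnn.
have n2 : m \notin w1' ++ w2' by apply/negP=> /(allP h') /=; rewrite ltnn.
rewrite !mem_cat !negb_or in n1 n2; case/andP: n1 => n1 _; case/andP: n2 => n2 _.
have sz : size w1 = size w1'.
  have := congr1 (index m) e.
  by rewrite !index_cat (negbTE n1) (negbTE n2) /= !eqxx !addn0.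
by move/eqP: e; rewrite eqseq_cat // => /andP[/eqP-> /eqP[->]]; split.
Qed.

Lemma col_insertion_covers (w : seq nat) x : uniq (x :: w) -> col_insertion w x ->
  exists g, covers g (sh w) (sh (x :: w)).
Proof.
move=> ux [h1 h2]; have [w1 [m [w2 [e wm]]]] := max_split ux isT.
case: w1 e wm => [|x' w1] [<- ew] wm.
  by subst w2; have [g cg _] := h1 wm; exists g.
have [a [g [r [cA cC cD er]]]] := h2 w1 m w2 ew wm.
exists (if a == g then r else g) => k; rewrite cD cC cA.
by case: eqP er => [->|_ ->]; lia.
Qed.

Lemma col_insertion_nil x : col_insertion [::] x.
Proof.
split=> [_|[]//]; exists 0 => // k.
by rewrite /sh /row_len /=; case: k => [|k]; rewrite /= ?nth_nil.
Qed.

(** Both conclusions are proved together: the induction uses column insertion into [u] and the slide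
    for [u] without its largest letter. The cases are whether the largest letter is [x], is [y], or
    lies in [u]. *)
Lemma col_insertion_jdt (u : seq nat) x y : uniq (x :: rcons u y) ->
  jdt_square (sh u) (sh (rcons u y)) (sh (x :: u)) (sh (x :: rcons u y)) /\
  col_insertion (rcons u y) x.
Proof.
have [n] := ubnP (size u); elim: n u y => // n IH u y; rewrite ltnS => szu uw.
have uxu : uniq (x :: u) by move: uw; rewrite -rcons_cons rcons_uniq => /andP[].
have uu : uniq u by case/andP: uxu.
have hu : col_insertion u x.
  case/lastP: u szu uxu {uw uu} => [|v z] szu uxu; first exact: col_insertion_nil.
  by rewrite size_rcons in szu; apply: (IH v z szu uxu).2.
have [w1 [m [w2 [e wm]]]] := max_split uw isT.
case: w1 e wm => [|x' w1] /= [<-].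
  move=> <- wm {w2 m}; have um : all (gtn x) u by move: wm; rewrite all_rcons => /andP[].
  have [g cg g0] := hu.1 um.
  have [a [b [r [cA cB cD er]]]] := @sh_row_rule [::] x u y wm.
  rewrite /= in cA cB cD; have eg := covers_inj cA cg; subst a.
  (* Both rows are empty, which allows the second alternative of [jdt_square] when [b = g]. *)
  have Sg : sh u g.+1 = sh u g by move: (antitone_sh uu (leqnSn g)); lia.
  split.
    exists b, g, (if b == g then g.+1 else b); split=> //; last first.
      by case: (eqVneq b g) => // _; right.
    by move=> k; rewrite cD cA cB er; case: (eqVneq b g) => [->|_]; lia.
  split=> [_|w1 m w2 ew /andP[/= xm _]]; last first.
    have : m \in rcons u y by rewrite ew mem_cat inE eqxx orbT.
    by move/(allP wm) => /= mx; lia.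
  exists r => //; rewrite cB er; case: (eqVneq g b) => [<-|]; lia.
case/lastP: w2 => [|w2 y'].
  rewrite cats1 cats0 => /rcons_inj[<- <-] /andP[xm wm] {x' w1 m}.
  have [g cg] := col_insertion_covers uxu hu.
  (* Here [y] is largest, so it is appended to row 0 with or without [x] in front. *)
  have cB := sh_rcons_max wm.
  have cD : covers 0 (sh (x :: u)) (sh (x :: rcons u y)).
    by rewrite -rcons_cons; apply: sh_rcons_max; rewrite /= xm.
  split; first by exists 0, g, 0; split=> //; case: eqP => // ->; left.
  split=> [|w1 m w2 ew /= /andP[_ h]].
    by rewrite all_rcons /= => /andP[]; lia.
  move: ew; rewrite -cats1 => ew.
  case: (max_split_inj ew) => //; first by rewrite cats0.
  move=> <- _ <-; rewrite cats0 cats1.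
  by exists 0, g, 0; split=> //; case: eqP => // <-.
rewrite -rcons_cons -rcons_cat => /rcons_inj[eu <-] {y'}.
rewrite -rcons_cat => /andP[xm wm].
subst u; have wm' : all (gtn m) (w1 ++ w2) by move: wm; rewrite all_rcons => /andP[].
have xwm : all (gtn m) (x :: w1 ++ w2) by rewrite /= xm.
have uw' : uniq (x :: rcons (w1 ++ w2) y).
  by move: uw; rewrite rcons_cat rcons_cons -cat_cons => /uniq_remove; rewrite rcons_cat.
have sz' : size (w1 ++ w2) < n by move: szu; rewrite !size_cat /= addnS.
have [jdt _] := IH _ _ sz' uw'.
have row1 := sh_row_rule wm.
have row2 : row_rule (sh (x :: w1 ++ w2)) (sh (x :: w1 ++ m :: w2))
    (sh (x :: rcons (w1 ++ w2) y)) (sh (x :: rcons (w1 ++ m :: w2) y)).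
  by apply: (@sh_row_rule (x :: w1) m w2 y); rewrite /= xm.
have col := hu.2 w1 m w2 erefl xwm.
have u2 : uniq (x :: w1 ++ w2) by apply: (@uniq_remove (x :: w1) w2 m).
have [colD jdtD] := jdt_cube (antitone_sh uu) (antitone_sh u2) (antitone_sh uxu)
  (antitone_sh uw') row1 col jdt row2.
have e : rcons (w1 ++ m :: w2) y = w1 ++ m :: rcons w2 y by rewrite rcons_cat.
split=> //; split=> [h|w1' m' w2'].
  have : m \in rcons (w1 ++ m :: w2) y by rewrite e mem_cat inE eqxx orbT.
  by move/(allP h) => /= mx; lia.
rewrite {1}e => ew /andP[_ h].
case: (max_split_inj ew) => //; first by rewrite -rcons_cat.
by move=> <- _ <-; rewrite -rcons_cat.
Qed.

Lemma col_insertionP (w : seq nat) x : uniq (x :: w) -> col_insertion w x.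
Proof.
by case/lastP: w => [|w y] uw; [apply: col_insertion_nil | case: (col_insertion_jdt uw)].
Qed.

(** The slide, read backwards: [S], [C] and [D] give [g] and [d], and these determine [b]. The only
    doubtful case is [d = g.+1] with rows [g] and [g.+1] of [S] equal; there [b = g.+1] would not
    yield a partition, so [b = g]. *)
Lemma eq_sh_behead x x' (v v' : seq nat) :
  uniq (x :: v) -> uniq (x' :: v') -> size v = size v' ->
  (forall k, sh (take k (x :: v)) =1 sh (take k (x' :: v'))) ->
  forall k, sh (take k v) =1 sh (take k v').
Proof.
move=> uv uv' szv chain; elim=> [|k IH]; first by rewrite !take0.
have [kv|kv] := leqP (size v) k.
  by move: IH; rewrite !take_oversize -?szv // ltnW.
have kv' : k < size v' by rewrite -szv.
have utake (z : nat) s j : uniq (z :: s) -> uniq (z :: take j s).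
  by move=> us; apply: (subseq_uniq _ us); rewrite /= eqxx take_subseq.
have := chain k.+1; have := chain k.+2; rewrite /=.
move: (utake x v k.+1 uv) (utake x' v' k.+1 uv').
rewrite (take_nth 0 kv) (take_nth 0 kv') => u1 u1' eD eC.
have [b [g [d [cB cC cD eb]]]] := (col_insertion_jdt u1).1.
have [b' [g' [d' [cB' cC' cD' eb']]]] := (col_insertion_jdt u1').1.
have aB := @antitone_sh (rcons (take k v) _) (proj2 (andP u1)).
have aB' := @antitone_sh (rcons (take k v') _) (proj2 (andP u1')).
have eg : g = g'.
  by apply: (covers_inj cC) => j; rewrite eC cC' IH.
have ed : d = d'.
  by apply: (covers_inj cD) => j; rewrite eD cD' eC.
subst g' d'; have eb2 : b = b'; last by subst b' => j; rewrite cB cB' IH.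
move: (aB g g.+1 (leqnSn g)) (aB' g g.+1 (leqnSn g)).
rewrite !cB !cB' -!IH in eb' *.
move: eb eb'; case: (eqVneq b g) => [->|bg]; case: (eqVneq b' g) => [->|bg'] //; lia.
Qed.

(** * Reversing a word conjugates its shape *)

Definition conjugate (S T : nat -> nat) : Prop := forall i j, (j < S i) = (i < T j).

(** The new cell [(i, S i)] transposes to [(S i, i)]; [T (S i) = i] makes this the cell just past
    the end of row [S i] of [T]. *)
Lemma conjugate_covers S T S' T' i : conjugate S T -> T (S i) = i ->
  covers i S S' -> covers (S i) T T' -> conjugate S' T'.
Proof.
move=> ST Ti cS cT k j; rewrite cS cT; move: (ST k j) (ST k (S i)) (ST i j).
have [->|ki] := eqVneq k i; have [->|ji] := eqVneq j (S i); rewrite ?Ti; lia.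
Qed.

Lemma conjugate_covers_inv S T S' T' i j : conjugate S T -> conjugate S' T' ->
  covers i S S' -> covers j T T' -> j = S i /\ T j = i.
Proof.
move=> ST S'T' cS cT.
move: (S'T' i (S i)) (ST i (S i)) (S'T' (T j) j) (ST (T j) j).
by rewrite !cS !cT !eqxx; lia.
Qed.

(** Reversal turns prepending into appending, and [col_rule] is the transpose of [row_rule]: the
    cell of the largest letter moves one column right in one, one row down in the other. *)
Lemma conjugate_sh_rev (w : seq nat) : uniq w -> conjugate (sh w) (sh (rev w)).
Proof.
have [n] := ubnP (size w); elim: n w => // n IH [|x v].
  by move=> _ _ i j; rewrite /sh /row_len /= !nth_nil.
rewrite [size _]/= !ltnS rev_cons => szv uw.
have uv : uniq v by case/andP: uw.
have cv := IH v szv uv; have [col0 colm] := col_insertionP uw.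
have aD := antitone_sh uw.
have [w1 [m [w2 [e wm]]]] := @max_split (x :: v) uw isT.
case: w1 e wm => [|x' w1] [<- ev] wm.
  subst w2; have [g cg g0] := col0 wm.
  have c0 : covers 0 (sh (rev v)) (sh (rcons (rev v) x)).
    by apply: sh_rcons_max; rewrite all_rev.
  apply: (conjugate_covers cv _ cg); rewrite g0 //.
  (* [g] is the first empty row of [sh v], hence the length of its first column, which is row 0 of
     the conjugate. *)
  move: (cv g 0) (cv (sh (rev v) 0) 0) (aD (sh (rev v) 0) g).
  by rewrite !cg g0 eqxx; lia.
have [a [g [r [cA cC cD er]]]] := colm w1 m w2 ev wm.
have [xm wm'] := andP wm; subst v.
have uv' := uniq_remove uv.
have uxv' : uniq (x :: w1 ++ w2) by apply: (@uniq_remove (x :: w1) w2 m).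
rewrite size_cat /= addnS in szv.
have cS : conjugate (sh (w1 ++ w2)) (sh (rev (w1 ++ w2))).
  by apply: IH; rewrite ?size_cat //; lia.
have cxS : conjugate (sh (x :: w1 ++ w2)) (sh (rcons (rev (w1 ++ w2)) x)).
  by rewrite -rev_cons; apply: IH; rewrite /= ?size_cat //; lia.
have eR : rev (w1 ++ m :: w2) = rev w2 ++ m :: rev w1.
  by rewrite rev_cat rev_cons cat_rcons.
have [a' [b [r' [cA' cB' cD' er']]]] : row_rule (sh (rev (w1 ++ w2)))
    (sh (rev (w1 ++ m :: w2))) (sh (rcons (rev (w1 ++ w2)) x))
    (sh (rcons (rev (w1 ++ m :: w2)) x)).
  rewrite eR rev_cat; apply: sh_row_rule.
  by rewrite all_rcons xm -rev_cat all_rev.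
have [ea' Ta'] := conjugate_covers_inv cS cv cA cA'.
have [eb Tb] := conjugate_covers_inv cS cxS cC cB'.
suff [er2 Tr] : r' = sh (x :: w1 ++ w2) r /\ sh (rcons (rev (w1 ++ w2)) x) r' = r.
  by rewrite er2 in Tr cD'; apply: conjugate_covers cxS Tr cD cD'.
move: er er'; case: (eqVneq a g) => [ag|ag].
  have -> : a' = b by rewrite ea' eb ag.
  rewrite eqxx => er er'.
  have er2 : r' = sh (x :: w1 ++ w2) r by rewrite er er' cC -ag eqxx eb ag addn1.
  split=> //.
  set t := sh (rcons _ _) r'; move: (cxS r r') (cxS t r') (aD t r).
  by rewrite !cD eqxx -/t -er2; lia.
have -> : (a' == b) = false by apply/eqP=> e; move: ag; rewrite -Ta' -Tb e eqxx.
move=> -> ->; rewrite cC cB' Ta' (negbTE ag) addn0; split=> //.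
by case: eqP => [e|]; [move: ag; rewrite -Ta' -Tb e eqxx | rewrite addn0].
Qed.

(** * Symmetric hooks and the induction on the word *)

Definition hook (m k : nat) : nat := if k is 0 then m.+1 else k <= m.

(** Symmetry at [(0, m.+1)] makes the first row grow exactly when the first column does. If neither
    end grows, the first new cell is [(1, 1)], and no second cell restores symmetry. *)
Lemma self_conjugate_hook S S1 S2 m p q : S =1 hook m ->
  covers p S S1 -> covers q S1 S2 -> antitone S1 -> antitone S2 ->
  conjugate S2 S2 -> S2 =1 hook m.+1.
Proof.
move=> eS c1 c2 a1 a2 sym.
have hp : p <= 1 \/ p = m.+1.
  case: p c1 => [|[|p]] c1; [by left | by left | right].
  move: (a1 p.+1 p.+2 (leqnSn _)); rewrite !c1 !eS /= eqxx ltn_eqF // addn0 addn1.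
  by rewrite leqNgt; case: (ltngtP p.+1 m) => //= ->.
have S2E k : S2 k = hook m k + (k == p) + (k == q) by rewrite c2 c1 eS.
have hpq : (p = 0 /\ q = m.+1) \/ (p = m.+1 /\ q = 0).
  have h0 : (0 == p) || (0 == q) = (m.+1 == p) || (m.+1 == q).
    have := sym 0 m.+1; rewrite !S2E /= ltnn add0n -addnA -[X in X < _]addn0 ltn_add2l.
    by do 4![case: (_ == _) => /=].
  move: h0; have [<- /= /esym/eqP<-|p0] := eqVneq 0 p; first by left.
  have [<- /= /eqP<-|pm] := eqVneq m.+1 p; first by right.
  have p1 : p = 1.
    by case: p p0 pm hp {c1 S2E} => [|[|p]] // _ pm [|e] //; rewrite e eqxx in pm.
  subst p; case: m pm {eS hp} S2E => // m _ S2E /= h0; exfalso.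
  move: (sym 1 2) (a2 q.-1 q (leq_pred q)); rewrite !S2E /= eqxx.
  case: q h0 {c2 S2E} => [|[|[|q]]] //=.
  - by case: m.
  - by case: m.
  by rewrite !eqSS !ltnS (ltn_eqF (ltnSn q)) !addn0; case: (ltngtP m q.+1).
move=> k; rewrite S2E; case: hpq => -[-> ->]; case: k => [|k];
  rewrite /= ?addn0 ?addn1 //; by rewrite eqSS ltnS; case: ltngtP.
Qed.

Lemma sh_self_reverse_hook (w : seq nat) : uniq w -> w != [::] ->
  (forall k, sh (take k w) =1 sh (take k (rev w))) ->
  exists m, sh w =1 hook m.
Proof.
have [n] := ubnP (size w); elim: n w => // n IH [|x v] // szw uw _ chain.
have sym : conjugate (sh (x :: v)) (sh (x :: v)).
  move=> i j; rewrite (conjugate_sh_rev uw); congr (_ < _).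
  by have := chain (size (x :: v)) j; rewrite !take_oversize ?size_rev.
have aw := antitone_sh uw.
case/lastP: v szw uw chain sym aw => [|u y] szw uw chain sym aw.
  by exists 0 => -[|k]; rewrite /sh /row_len //= nth_nil.
have [q cq] := col_insertion_covers uw (col_insertionP uw).
have uuy : uniq (rcons u y) by case/andP: uw.
have uu : uniq u by move: uuy; rewrite rcons_uniq => /andP[].
have [p cp] := sh_rcons u y.
(* Two letters form one row or one column, neither of them symmetric. *)
have [u0|u0] := eqVneq u [::].
  subst u; have p0 := covers_inj cp (@sh_rcons_max [::] y isT); subst p.
  move: (aw 1 q) (sym 0 1); rewrite !cq !cp /sh /row_len /= !nth_nil /=.
  by move=> ??; exfalso; lia.
have eR : rev (x :: rcons u y) = y :: rcons (rev u) x by rewrite rev_cons rev_rcons.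
have chain' k : sh (take k (rcons u y)) =1 sh (take k (rcons (rev u) x)).
  apply: (@eq_sh_behead x y) => //; rewrite ?size_rcons ?size_rev //.
    by rewrite -eR rev_uniq.
  by rewrite -eR.
have szu : size u < n by move: szw; rewrite /= size_rcons; lia.
have [k|m hm] := IH u szu uu u0.
  (* Prefixes this short do not reach the last letters [y] and [x]. *)
  wlog ku : k / k <= size u.
    move=> h; have [|ku] := leqP k (size u); first exact: h.
    by have := h _ (leqnn _); rewrite !take_oversize ?size_rev // ltnW.
  by have := chain' k; rewrite -!cats1 !takel_cat ?size_rev.
exists m.+1; apply: (self_conjugate_hook hm cp cq) => //.
exact: antitone_sh.
Qed.

(** * From recording tableaux to shapes *)

(** Insertion number [k] writes [k] into the cell it creates, so the recording tableau encodes the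
    whole chain of prefix shapes. *)
Lemma count_recording (w : seq nat) k i :
  count (geq k) (nth [::] (RS w).2 i) = sh (take k w) i.
Proof.
elim/last_ind: w k i => [|w x IH] k i; first by rewrite /sh /row_len /= nth_nil.
have := tab_insert_index x (Ptab w); have := Ptab_rcons w x.
rewrite RS_rcons /RS_step /= -/(Ptab w).
case: tab_insert => T' j /= eT [cov _ _].
rewrite nth_set_nth /=; have [kw|kw] := leqP k (size w).
  have -> : take k (rcons w x) = take k w by rewrite -cats1 takel_cat.
  rewrite -IH; case: eqP => [->|//].
  by rewrite -cats1 count_cat /= addn0 leqNgt ltnS kw addn0.
rewrite take_oversize ?size_rcons // /sh eT cov.
have := IH k i; rewrite take_oversize ?(ltnW kw) // /sh => <-.
by case: eqP => [->|_]; rewrite ?addn0 // -cats1 count_cat /= kw addn0.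
Qed.

Lemma row_len_recording w : row_len (RS w).2 =1 sh w.
Proof.
elim/last_ind: w => [|w x IH] i //.
have := tab_insert_index x (Ptab w); have := Ptab_rcons w x.
rewrite RS_rcons /RS_step /= -/(Ptab w).
case: tab_insert => T' j /= eT [cov _ _].
by rewrite row_len_add_cell IH /sh eT cov.
Qed.

(** A row-length function does not see trailing empty rows; excluding them lets the list [shape] be
    recovered from it. *)
Lemma recording_row_gt0 w : size (RS w).2 = size (Ptab w) /\
  forall k, (0 < row_len (RS w).2 k) = (k < size (RS w).2).
Proof.
elim/last_ind: w => [|w x [szQ IH]].
  by split=> // k; rewrite /row_len nth_nil.
have := tab_insert_index x (Ptab w); have := Ptab_rcons w x.
rewrite RS_rcons /RS_step /= -/(Ptab w).
case: tab_insert => T' j /= eT [cov jT szT]; rewrite eT szT size_set_nth szQ.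
by split=> // k; rewrite row_len_add_cell; move: (IH k); rewrite szQ; lia.
Qed.

Lemma row_len_shape T k : nth 0 (shape T) k = row_len T k.
Proof.
rewrite /row_len /shape; have [kT|Tk] := ltnP k (size T).
  by rewrite (nth_map [::]).
by rewrite !nth_default ?size_map.
Qed.

Lemma one_line_uniq n (w : 'S_n) : uniq (one_line w).
Proof.
rewrite map_inj_uniq ?enum_uniq // => i j /succn_inj /val_inj.
exact: perm_inj.
Qed.

Theorem theorem2p8 (n : nat) (n_ge1 : 1 <= n) : R_set n \subset H_set n.
Proof.
apply/subsetP=> w; rewrite !inE /Qtab one_line_rev => /eqP eQ.
have w0 : one_line w != [::] by rewrite -size_eq0 size_map size_enum_ord -lt0n.
have [k i|m hm] := sh_self_reverse_hook (one_line_uniq w) w0.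
  by rewrite -!count_recording eQ.
apply/symmetric_hookP; exists m.
have [_ gt0] := recording_row_gt0 (one_line w).
set Q := (RS _).2 in gt0 *.
have szQ : size Q = m.+1.
  (* [hook m] is positive at [m] and zero at [m.+1]. *)
  move: (gt0 m) (gt0 m.+1); rewrite !row_len_recording !hm /=.
  by case: (m) => [|m'] /=; lia.
apply: (@eq_from_nth _ 0) => [|i]; first by rewrite size_map szQ /= size_nseq.
rewrite size_map szQ row_len_shape row_len_recording hm.
by case: i => [|i] //= im; rewrite nth_nseq -ltnS im.
Qed.
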